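(* Let $0<c_1\le c_2<1$ be real values such that $c_1>c_1^*(c_2)$. Then there exists an $n_0 = O\left(\mathrm{poly}\left(\frac{1}{c_1-c_1^*(c_2)}\right)\right)$ such that for any $n\ge n_0$, any degree sequence $D$ of length $n$ with degrees between $c_1\binom{n-1}{2}$ and $c_2\binom{n-1}{2}$ has a $3$-uniform hypergraph realization if and only if the sum of its degrees can be divided by $3$. In particular, any degree sequence $D$ of length $n\ge n_0$ in $\mathcal{D}_{c_1,c_2}$ is graphic.
   Context: A hypergraph $H=(V,E)$ is $3$-uniform if $E\subseteq \binom{V}{3}$; the degree $d(v)$ of a vertex is the number of hyperedges containing it. A degree sequence is a finite sequence of non-negative integers. A $3$-uniform hypergraph on $v_1,\dots,v_n$ is a realization of $D=(d_1,\dots,d_n)$ if $d(v_i)=d_i$ for all $i$; $D$ is graphic if it has a $3$-uniform hypergraph realization. For $c_1,c_2>0$, $\mathcal{D}_{c_1,c_2}$ is the class of degree sequences such that each $D=(d_1,\dots,d_n)\in\mathcal{D}_{c_1,c_2}$ of length $n$ satisfies $\sum_i d_i\equiv 0\pmod 3$ and $c_1\binom{n-1}{2}\le d_i\le c_2\binom{n-1}{2}$ for all $i$. For $c_2\in(0,1)$, $c_1^*(c_2):=\max_{\alpha\in(0,1)} C\left(\alpha,\frac{c_2}{2}\right)$, where $$C(\alpha,d)=\begin{cases}0 & d\le \frac{\alpha^2}{2},\\ \frac{\alpha}{1-\alpha}\left(\frac{2d-\alpha^2}{2}\right) & \frac{\alpha^2}{2}<d\le \alpha\left(1-\frac{\alpha}{2}\right),\\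 \frac{2\alpha}{1-\alpha}(2d-\alpha^2)-3\alpha^2 & d>\alpha\left(1-\frac{\alpha}{2}\right).\end{cases}$$ $\mathrm{poly}$ denotes some polynomial. *)

(* Defs.v *)
From mathcomp Require Import all_boot all_order all_algebra.
From mathcomp Require Import all_classical all_reals all_analysis.
From mathcomp Require Import ring lra.
Import Order.TTheory GRing.Theory Num.Theory.
Import numFieldNormedType.Exports.

Set Implicit Arguments.
Unset Strict Implicit.
Unset Printing Implicit Defensive.

Local Open Scope ring_scope.

Definition uniform3 (T : finType) (E : {set {set T}}) : Prop :=
  forall e, e \in E -> #|e| = 3%N.

Definition hdegree (T : finType) (E : {set {set T}}) (v : T) : nat :=
  #|[set e in E | v \in e]|.

Definition realization (n : nat) (D : n.-tuple nat) (E : {set {set 'I_n}}) :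
    Prop :=
  uniform3 E /\ forall i : 'I_n, hdegree E i = tnth D i.

Definition graphic (n : nat) (D : n.-tuple nat) : Prop :=
  exists E : {set {set 'I_n}}, realization D E.

Definition degrees_between (R : realType) (c1 c2 : R) (n : nat)
    (D : n.-tuple nat) : Prop :=
  forall i : 'I_n,
    c1 * 'C(n.-1, 2)%:R <= (tnth D i)%:R <= c2 * 'C(n.-1, 2)%:R.

Definition degree_class (R : realType) (c1 c2 : R) (n : nat)
    (D : n.-tuple nat) : Prop :=
  (\sum_(i < n) tnth D i = 0 %[mod 3])%N /\ degrees_between c1 c2 D.

Definition Cfun (R : realType) (alpha d : R) : R :=
  if d <= alpha ^+ 2 / 2 then 0
  else if d <= alpha * (1 - alpha / 2) then
    alpha / (1 - alpha) * ((2 * d - alpha ^+ 2) / 2)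
  else 2 * alpha / (1 - alpha) * (2 * d - alpha ^+ 2) - 3 * alpha ^+ 2.

(* For 0 < c2 < 1 the supremum is attained: see [c1star_max]. *)
Definition c1star (R : realType) (c2 : R) : R :=
  sup [set Cfun alpha (c2 / 2) | alpha in `]0, 1[%classic]%classic.

Section Maximum.
Variables (R : realType) (c2 : R).
Hypotheses (c2_gt0 : 0 < c2) (c2_lt1 : c2 < 1).

Let g (a : R) : R := a / (1 - a) * (c2 - a ^+ 2).
Let h (a : R) : R := Num.max 0 (Num.max (g a / 2) (2 * g a - 3 * a ^+ 2)).

Let CfunE (a : R) : 0 < a -> a < 1 -> Cfun a (c2 / 2) = h a.
Proof.
move=> a0 a1; have b0 : 0 < 1 - a by lra.
have q0 : 0 < a / (1 - a) by rewrite divr_gt0.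
have qE : a / (1 - a) * (1 - a) = a by rewrite divfK// gt_eqF.
have -> : Cfun a (c2 / 2) = if c2 / 2 <= a ^+ 2 / 2 then 0
  else if c2 / 2 <= a * (1 - a / 2) then g a / 2 else 2 * g a - 3 * a ^+ 2.
  rewrite /Cfun /g.
  have -> : 2 * (c2 / 2) = c2 by lra.
  by rewrite -(mulrA 2) -!mulrA.
rewrite /h; have a20 : 0 <= a ^+ 2 by rewrite sqr_ge0.
case: ifPn => [H1|]; last rewrite -ltNge => H1.
  have g0 : g a <= 0 by rewrite /g pmulr_rle0//; lra.
  by rewrite max_l// ge_max; apply/andP; split; lra.
have g0 : 0 < g a by rewrite /g pmulr_rgt0//; lra.
have gE : g a - 2 * a ^+ 2 = a / (1 - a) * (c2 - (2 * a - a ^+ 2)).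
  apply/eqP; rewrite /g -subr_eq0; apply/eqP.
  move: qE; set q := a / (1 - a) => qE.
  by transitivity (2 * a * (q * (1 - a) - a)); [ring|rewrite qE subrr mulr0].
case: ifPn => [H2|]; last rewrite -ltNge => H2.
  have : g a - 2 * a ^+ 2 <= 0 by rewrite gE pmulr_rle0//; nra.
  move=> H; rewrite (max_l (x := g a / 2)); last by lra.
  by rewrite max_r//; lra.
have : 0 < g a - 2 * a ^+ 2 by rewrite gE pmulr_rgt0//; nra.
move=> H; rewrite (max_r (x := g a / 2)); last by lra.
by rewrite max_r//; lra.
Qed.

Let s : R := (1 + c2) / 2.

Let s_lt1 : s < 1.
Proof. by rewrite /s ltr_pdivrMr// mul1r -natr1 [ltRHS]addrC ltrD2l. Qed.

Let h_continuous : {within `[0, s]%classic, continuous h}%classic.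
Proof.
apply: continuous_in_subspaceT => a /[!inE]/= /[!in_itv]/= /andP[a0 as_].
have b0 : 1 - a != 0 by rewrite gt_eqF// subr_gt0 (le_lt_trans as_ s_lt1).
have cg : {for a, continuous g}.
  rewrite /g; apply: (@cvgM _ _ _ _ (fun a => a / (1 - a))).
    apply: cvgM; first exact: cvg_id.
    by apply: cvgV => //; apply: cvgB; [exact: cvg_cst|exact: cvg_id].
  by apply: cvgB; [exact: cvg_cst|exact: exprn_continuous].
rewrite /h; apply: (@continuous_max _ _ (fun=> 0) (fun a => Num.max (g a / 2) (2 * g a - 3 * a ^+ 2))); first exact: cvg_cst.
apply: (@continuous_max _ _ (fun a => g a / 2) (fun a => 2 * g a - 3 * a ^+ 2)).
  by apply: cvgM; [exact: cg|exact: cvg_cst].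
apply: cvgB; apply: cvgM; [exact: cvg_cst|exact: cg|exact: cvg_cst|].
exact: exprn_continuous.
Qed.

Lemma c1star_max :
  (exists2 a : R, 0 < a < 1 & Cfun a (c2 / 2) = c1star c2) /\
  (forall a : R, 0 < a < 1 -> Cfun a (c2 / 2) <= c1star c2).
Proof.
suff [a a01 maxa] : exists2 a : R, 0 < a < 1 &
    forall b, 0 < b < 1 -> Cfun b (c2 / 2) <= Cfun a (c2 / 2).
  have supE : c1star c2 = Cfun a (c2 / 2).
    apply/eqP; rewrite eq_le; apply/andP; split.
      apply: ge_sup; first by exists (Cfun a (c2 / 2)), a => //=; rewrite in_itv.
      by move=> _ [b /= + <-]; rewrite in_itv/=; exact: maxa.
    apply: ub_le_sup; last by exists a => //=; rewrite in_itv.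
    exists (Cfun a (c2 / 2)) => _ [b /= + <-].
    by rewrite in_itv/=; exact: maxa.
  by rewrite supE; split; first exists a.
have s0 : 0 <= s by rewrite /s divr_ge0// addr_ge0// ltW.
have h0 b : 0 <= h b by rewrite /h le_max lexx.
have [a] := EVT_max s0 h_continuous; rewrite in_itv/= => /andP[a0 as_] maxa.
have Cle b : 0 < b < 1 -> Cfun b (c2 / 2) <= h a.
  move=> /andP[b0 b1]; have [bs|sb] := leP b s.
    by rewrite CfunE//; apply: maxa; rewrite in_itv/= bs ltW.
  rewrite /Cfun ifT//; rewrite ler_pM2r ?invr_gt0//.
  apply: (@le_trans _ _ (s ^+ 2)); first last.
    by rewrite lerXn2r ?nnegrE// ltW.
  rewrite -subr_ge0 (_ : _ - _ = ((1 - c2) / 2) ^+ 2) ?sqr_ge0//.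
  by rewrite /s; field.
move: a0; rewrite le_eqVlt => /predU1P[a0|a0]; last first.
  have a1 : a < 1 by exact: le_lt_trans s_lt1.
  by exists a; [rewrite a0|move=> b /Cle; rewrite (CfunE a0 a1)].
exists (1 / 2); first by apply/andP; split; lra.
move=> b /Cle /le_trans; apply.
rewrite CfunE; [|lra..].
suff -> : h a = 0 by [].
rewrite -a0 /h /g !mul0r expr0n/= !mulr0 subr0.
by rewrite !maxxx.
Qed.

End Maximum.

(* Main.v *)
Require Import Defs.
From mathcomp Require Import all_boot all_order all_algebra.
From mathcomp Require Import all_classical all_reals all_analysis.
From mathcomp Require Import zify ring lra.
Import Order.TTheory GRing.Theory Num.Theory.
Local Open Scope ring_scope.

Set Implicit Arguments.
Unset Strict Implicit.
Unset Printing Implicit Defensive.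

(** If [deg i > deg j], some edge through [i] but not [j] can be replaced by
    the edge with [j] instead of [i], so one unit of degree moves from [i] to
    [j].  Hence only class sums matter: it suffices to find a set [A] of the [a]
    largest prescribed degrees, and a hypergraph with [M] edges ([3 M] being the
    prescribed sum), whose average degree is at least the maximum [U] on [A] and
    at most the minimum [L] off [A]; levelling [A] and its complement and then
    moving units from [A] outwards reaches the prescribed degrees.  The best
    such hypergraph takes triples greedily by the size of their intersection
    with [A], and the two nontrivial branches of [Cfun] are what this requires
    of [L] when all degrees are [L] or [U].  With [e = c1 - c1star c2], the
    rounding errors are absorbed by the slack [e] when [n - a >= 2 / e];
    otherwise [A] is almost everything, and since [1 - c2 >= e ^+ 2 / 8] the
    triples inside [A] suffice. *)

Section Combinatorics.
Local Open Scope nat_scope.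

(** * Degree sums and moving one unit of degree *)

Definition realizable (T : finType) (h : T -> nat) : Prop :=
  exists2 E : {set {set T}}, uniform3 E & hdegree E =1 h.

Lemma realizable_ext (T : finType) (h g : T -> nat) :
  h =1 g -> realizable h -> realizable g.
Proof. by move=> hg [E uE Eh]; exists E => // v; rewrite Eh. Qed.

Lemma hdegreeE (T : finType) (E : {set {set T}}) v :
  hdegree E v = \sum_(e in E) (v \in e).
Proof.
rewrite /hdegree -sum1_card big_mkcond /= [RHS]big_mkcond /=.
by apply: eq_bigr => e _; rewrite inE; case: (e \in E); case: (v \in e).
Qed.

Lemma sum_hdegree (T : finType) (E : {set {set T}}) (A : {set T}) :
  \sum_(v in A) hdegree E v = \sum_(e in E) #|e :&: A|.
Proof.
under eq_bigr do rewrite hdegreeE.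
rewrite exchange_big /=; apply: eq_bigr => e _.
rewrite -sum1_card big_mkcond /= [RHS]big_mkcond /=.
by apply: eq_bigr => v _; rewrite inE; case: (v \in A); case: (v \in e).
Qed.

Lemma handshake (T : finType) (E : {set {set T}}) :
  uniform3 E -> \sum_v hdegree E v = 3 * #|E|.
Proof.
move=> uE; transitivity (\sum_(v in [set: T]) hdegree E v).
  by apply: eq_bigl => v; rewrite inE.
rewrite sum_hdegree mulnC -sum_nat_const.
by apply: eq_bigr => e /uE eE; rewrite finset.setIT eE.
Qed.

(** Edges through both vertices cancel from the two degrees, so those through [i] only outnumber
    those through [j] only. Replacing [i] by [j] is injective on the former, hence some image is not
    yet an edge. *)
Lemma realizable_flip (T : finType) (h : T -> nat) (i j : T) :
  realizable h -> h j < h i ->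
  realizable (fun v => h v - (v == i) + (v == j)).
Proof.
move=> [E uE Eh] ji.
have nij : i != j by apply: contraTneq ji => ->; rewrite ltnn.
have nji : (j == i) = false by rewrite eq_sym; apply/negbTE.
pose X := [set e in E | (i \in e) && (j \notin e)].
pose Y := [set e in E | (j \in e) && (i \notin e)].
pose s (e : {set T}) := j |: (e :\ i).
have XY : #|Y| < #|X|.
  move: ji; rewrite -!Eh /hdegree.
  rewrite -(cardsID [set e : {set T} | i \in e] [set e in E | j \in e]).
  rewrite -(cardsID [set e : {set T} | j \in e] [set e in E | i \in e]).
  have -> : [set e in E | j \in e] :&: [set e : {set T} | i \in e]
          = [set e in E | i \in e] :&: [set e : {set T} | j \in e].
    by apply/setP => e; rewrite !inE -!andbA [(j \in e) && _]andbC.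
  rewrite ltn_add2l; congr (_ < _); apply: eq_card => e; rewrite !inE.
    by case: (e \in E); rewrite //= andbC.
  by case: (e \in E); rewrite //= andbC.
have s_inj : {in X &, injective s}.
  move=> e f; rewrite !inE => /and3P[_ ie je] /and3P[_ jf jf'] /setP ef.
  apply/setP => v; move: (ef v); rewrite !inE.
  case: (eqVneq v i) => [->|_]; first by rewrite ie jf.
  by case: (eqVneq v j) => [->|_] //=; rewrite (negbTE je) (negbTE jf').
have [e eX seE] : exists2 e : {set T}, e \in X & s e \notin E.
  apply/exists_inP; apply: contraLR XY => /exists_inPn H; rewrite -leqNgt.
  rewrite -(card_in_imset s_inj); apply/subset_leq_card/fintype.subsetP => f.
  move=> /imsetP[e eX ->]; have := H _ eX; rewrite negbK => sE.
  by rewrite !inE sE !eqxx /= negb_or nij.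
move: eX; rewrite inE => /and3P[eE ie je].
exists (s e |: (E :\ e)).
  move=> f; rewrite !inE => /orP[/eqP->|/andP[_ /uE//]].
  rewrite /s cardsU1 !inE (negbTE je) andbF /=.
  by have := cardsD1 i e; rewrite ie (uE _ eE) => <-.
move=> v; rewrite -Eh !hdegreeE big_setU1 /=; last by rewrite !inE negb_and seE orbT.
rewrite [\sum_(f in E) _](big_setD1 e) //=.
set S := \sum_(_ in _) _; rewrite !inE.
case: (eqVneq v i) => [->|vi]; first by rewrite ie (negbTE nij) /=; lia.
case: (eqVneq v j) => [->|vj]; first by rewrite (negbTE je) /=; lia.
by rewrite /=; lia.
Qed.

Lemma eq_sum_deficit (T : finType) (A : {set T}) (f g : T -> nat) (i : T) :
  i \in A -> g i < f i -> \sum_(v in A) f v = \sum_(v in A) g v ->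
  exists2 j, j \in A & f j < g j.
Proof.
move=> iA gf fg; apply/exists_inP; apply: contraT => /exists_inPn H.
suff : \sum_(v in A) g v < \sum_(v in A) f v by rewrite fg ltnn.
rewrite (big_setD1 i) //= [ltnRHS](big_setD1 i) //=.
rewrite -addSn leq_add // leq_sum // => j; rewrite !inE => /andP[_ jA].
by rewrite leqNgt H.
Qed.

Lemma sum_move (T : finType) (A : {set T}) (h : T -> nat) (i j : T) :
  (i \in A) = (j \in A) -> i != j -> 0 < h i ->
  \sum_(v in A) (h v - (v == i) + (v == j)) = \sum_(v in A) h v.
Proof.
move=> ij nij hi; have nji : (j == i) = false by rewrite eq_sym (negbTE nij).
have [iA|iA] := boolP (i \in A); last first.
  apply: eq_bigr => v vA.
  have -> : v == i = false by apply: contraNF iA => /eqP <-.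
  have -> : v == j = false by apply: contraNF iA => /eqP vj; rewrite ij -vj.
  by rewrite subn0 addn0.
have jA : j \in A by rewrite -ij.
have jA' : j \in A :\ i by rewrite !inE nji jA.
rewrite (big_setD1 i) // (big_setD1 j) //= [RHS](big_setD1 i) //=.
rewrite [in RHS](big_setD1 j) //= !eqxx nji (negbTE nij) subn0 addn0.
rewrite (eq_bigr h) => [|v]; last first.
  by rewrite !inE => /and3P[/negbTE-> /negbTE-> _]; rewrite subn0 addn0.
by rewrite subn1 addnA addn1 addnS -addSn prednK // addnA.
Qed.

(* The last hypothesis ensures [h j < h i], so that a unit can be moved from the
   vertex [i] of excess degree to the deficient [j]; it survives such moves. *)
Lemma realizable_transfer (T : finType) (A : {set T}) (h d : T -> nat) :
  realizable h ->
  \sum_(v in A) h v = \sum_(v in A) d v ->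
  \sum_(v in ~: A) h v = \sum_(v in ~: A) d v ->
  (forall i j, (i \in A) = (j \in A) -> d i < h i -> h j < d j ->
     d j <= (d i).+1) ->
  realizable d.
Proof.
(* Induction on the total excess: a move lowers it by one at [i] and creates none at the deficient
   [j]. *)
have [k] := ubnP (\sum_v (h v - d v)).
elim: k h => // k IH h; rewrite ltnS => hk rh sA sB dd.
have [[i di]|hd] := pselect (exists i, d i < h i); last first.
  have le v : h v <= d v by rewrite leqNgt; apply/negP => ?; apply: hd; exists v.
  apply: realizable_ext rh => v; apply/eqP; rewrite eqn_leq le /= leqNgt.
  apply/negP => vd.
  have [vA|vA] := boolP (v \in A).
    by have [j _] := eq_sum_deficit vA vd (esym sA); rewrite ltnNge le.
  have vA' : v \in ~: A by rewrite inE.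
  by have [j _] := eq_sum_deficit vA' vd (esym sB); rewrite ltnNge le.
have [j ij jd] : exists2 j, (i \in A) = (j \in A) & h j < d j.
  have [iA|iA] := boolP (i \in A).
    by have [j jA ?] := eq_sum_deficit iA di sA; exists j => //; rewrite jA.
  have iA' : i \in ~: A by rewrite inE.
  have [j + ?] := eq_sum_deficit iA' di sB.
  by rewrite inE => jA; exists j => //; apply/esym/negbTE.
have nij : i != j by apply: contraTneq di => ->; rewrite -leqNgt ltnW.
have nji : (j == i) = false by rewrite eq_sym (negbTE nij).
have ji : h j < h i.
  by rewrite (leq_trans jd) // (leq_trans (dd _ _ ij di jd)).
have hi : 0 < h i by apply: leq_trans ji.
apply: (IH _ _ (realizable_flip rh ji)); last 3 first.
- by rewrite sum_move.
- by rewrite sum_move // !inE ij.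
- move=> u v uv; case: (eqVneq u j) => [->|uj].
    by rewrite nji subn0 addn1 leqNgt ltnS jd.
  rewrite addn0 => du.
  case: (eqVneq v i) => [->|vi].
    by rewrite (negbTE nij) addn0 subn1 ltnNge -ltnS prednK // di.
  rewrite subn0 => hv; apply: dd => //.
    by apply: leq_trans du (leq_subr _ _).
  by apply: leq_ltn_trans hv; apply: leq_addr.
apply: leq_trans hk.
rewrite (bigD1 i) //= [ltnRHS](bigD1 i) //= -addSn leq_add //.
  by rewrite eqxx (negbTE nij); lia.
apply: leq_sum => v vi; rewrite (negbTE vi) subn0.
case: (eqVneq v j) => [->|_]; last by rewrite addn0.
by rewrite addn1 (eqP (_ : (h j).+1 - d j == 0)) // subn_eq0.
Qed.

(** * Levelled functions and greedy choices *)

(** Units are added one at a time, each to a smallest value. *)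
Lemma exists_balanced (T : finType) (A : {set T}) (s : nat) :
  0 < #|A| -> exists2 t : T -> nat, \sum_(v in A) t v = s &
    {in A &, forall i j, t i <= (t j).+1}.
Proof.
move=> /card_gt0P[x0 x0A]; elim: s => [|s [t ts tb]].
  by exists (fun=> 0); rewrite // big1.
have [i iA imin] := arg_minnP t x0A.
exists (fun v => t v + (v == i)).
  rewrite big_split /= ts (big_setD1 i) //= eqxx big1 ?addn0 ?addn1 // => v.
  by rewrite !inE => /andP[/negbTE->].
move=> u v uA vA; have := imin _ vA; have := imin _ uA; have := tb _ _ uA vA.
by case: (eqVneq u i) => [->|_]; case: (v == i); rewrite ?addn1 ?addn0 => *; lia.
Qed.

Lemma balanced_ge (T : finType) (A : {set T}) (t : T -> nat) (u : nat) :
  {in A &, forall i j, t i <= (t j).+1} -> #|A| * u <= \sum_(v in A) t v ->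
  {in A, forall i, u <= t i}.
Proof.
move=> tb su i iA; rewrite leqNgt; apply/negP => tu.
suff : \sum_(v in A) t v < #|A| * u by rewrite ltnNge su.
rewrite -sum_nat_const (big_setD1 i) //= [ltnRHS](big_setD1 i) //=.
rewrite -addSn leq_add // leq_sum // => j; rewrite !inE => /andP[_ jA].
by apply: leq_trans (tb _ _ jA iA) tu.
Qed.

Lemma balanced_le (T : finType) (A : {set T}) (t : T -> nat) (l : nat) :
  {in A &, forall i j, t i <= (t j).+1} -> \sum_(v in A) t v <= #|A| * l ->
  {in A, forall i, t i <= l}.
Proof.
move=> tb su i iA; rewrite leqNgt; apply/negP => tu.
suff : #|A| * l < \sum_(v in A) t v by rewrite ltnNge su.
rewrite -sum_nat_const (big_setD1 i) //= [ltnRHS](big_setD1 i) //=.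
rewrite -addSn leq_add // leq_sum // => j; rewrite !inE => /andP[_ jA].
by rewrite -ltnS (leq_trans tu) // tb.
Qed.

Lemma top_set (T : finType) (P : {set T}) (w : T -> nat) (m : nat) :
  m <= #|P| -> exists A : {set T}, [/\ A \subset P, #|A| = m &
    forall x y, x \in A -> y \in P :\: A -> w y <= w x].
Proof.
elim: m => [_|m IH mP].
  by exists finset.set0; split; rewrite ?finset.sub0set ?cards0 // => x y; rewrite finset.in_set0.
have [A [AP Am Atop]] := IH (ltnW mP).
have : 0 < #|P :\: A| by rewrite cardsD (finset.setIidPr AP) Am subn_gt0.
move=> /card_gt0P[x0 x0P].
have [i iP imax] := arg_maxnP w x0P.
have /finset.setDP[iP' iA] : i \in P :\: A by exact: iP.
exists (i |: A); split.
- by rewrite finset.subUset finset.sub1set iP'.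
- by rewrite cardsU1 iA Am.
move=> x y; rewrite !inE negb_or => /orP[/eqP->|xA] /andP[/andP[yi yA] yP].
  by apply: imax; apply/finset.setDP.
by apply: Atop; rewrite // inE yA.
Qed.

(** The threshold [w x0] is the least weight on [E], so the truncated differences vanish off [E].
    The right-hand side depends on [E] only through its size and the threshold: a bound for each
    possible threshold bounds the greedy weight. *)
Lemma top_set_weight (T : finType) (P E : {set T}) (w : T -> nat) :
  E \subset P -> 0 < #|E| ->
  (forall x y, x \in E -> y \in P :\: E -> w y <= w x) ->
  exists2 x0, x0 \in E &
    \sum_(x in E) w x = #|E| * w x0 + \sum_(x in P) (w x - w x0).
Proof.
move=> EP /card_gt0P[x1 x1E] top; have [x0 x0E xmin] := arg_minnP w x1E.
exists x0 => //; rewrite [X in _ = _ + X](finset.big_setID E) /= (finset.setIidPr EP).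
rewrite [X in _ + (_ + X)]big1 => [|y yE]; last first.
  by apply/eqP; rewrite subn_eq0 top.
rewrite addn0 -sum_nat_const -big_split /=; apply: eq_bigr => x xE.
by rewrite subnKC // xmin.
Qed.

(** * Counting triples by their intersection with a set *)

Definition triples (T : finType) : {set {set T}} := [set e : {set T} | #|e| == 3].

Lemma card_triples (T : finType) : #|triples T| = 'C(#|T|, 3).
Proof.
rewrite -cardsT -cards_draws; apply: eq_card => e.
by rewrite !inE finset.subsetT.
Qed.

Lemma hdegree_triples (T : finType) (v : T) :
  'C(#|T|.-1, 2) <= hdegree (triples T) v.
Proof.
have -> : #|T|.-1 = #|~: [set v]| by rewrite cardsC1.
rewrite -cards_draws.
rewrite -(@card_in_imset _ _ (fun p => v |: p)) => [|p q]; last first.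
  rewrite !inE => /andP[/fintype.subsetP pv _] /andP[/fintype.subsetP qv _] /setP pq.
  apply/setP => x; have := pq x; rewrite !inE.
  case: (eqVneq x v) => [->|//] _.
  apply/idP/idP => [/pv|/qv]; by rewrite !inE eqxx.
apply/subset_leq_card/fintype.subsetP => _ /imsetP[p + ->].
rewrite inE => /andP[/fintype.subsetP pv /eqP p2].
rewrite !inE eqxx andbT cardsU1 p2.
by have [/pv|//] := boolP (v \in p); rewrite !inE eqxx.
Qed.

(** The form [- 0] matches the last sum of [top_set_weight] at threshold 0; the analogues below
    serve thresholds 2 and 1. *)
Lemma sum_triples_subn0 (T : finType) (A : {set T}) :
  #|A| * 'C(#|T|.-1, 2) <= \sum_(e in triples T) (#|e :&: A| - 0).
Proof.
under eq_bigr do rewrite subn0.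
rewrite -sum_hdegree -sum_nat_const; apply: leq_sum => v _.
exact: hdegree_triples.
Qed.

Lemma sum_triples_subn2 (T : finType) (A : {set T}) :
  'C(#|A|, 3) <= \sum_(e in triples T) (#|e :&: A| - 2).
Proof.
rewrite -cards_draws -sum1_card big_mkcond /= [leqRHS]big_mkcond /=.
apply: leq_sum => e _; rewrite !inE; case: ifP => // /andP[eA /eqP e3].
by rewrite (finset.setIidPl eA) e3.
Qed.

(** Adding an outside point to a pair in [A] is injective: intersecting with [A] recovers the
    pair. *)
Lemma card_triples_cross (T : finType) (A : {set T}) :
  'C(#|A|, 2) * (#|T| - #|A|) <= #|[set e in triples T | #|e :&: A| == 2]|.
Proof.
have -> : #|T| - #|A| = #|~: A| by rewrite -(cardsC A) addKn.
rewrite -cards_draws -cardsX.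
pose f (x : {set T} * T) := x.2 |: x.1.
have fA (p : {set T}) v : p \subset A -> v \notin A -> (v |: p) :&: A = p.
  move=> /fintype.subsetP pA vA; apply/setP => x; rewrite !inE.
  case: (eqVneq x v) => [->|_] /=; last first.
    by apply/andP/idP => [[]//|xp]; rewrite xp pA.
  by rewrite (negbTE vA); apply/esym; apply: contraNF vA => /pA.
rewrite -(@card_in_imset _ _ f) => [|[p v] [q u]]; last first.
  rewrite !inE /= => /andP[/andP[pA _] vA] /andP[/andP[qA _] uA].
  rewrite /f /= => pq.
  have epq : p = q by rewrite -(fA _ _ pA vA) pq fA.
  subst q; congr pair; apply/eqP.
  have := setU11 v p; rewrite pq !inE => /orP[//|vp].
  by rewrite (fintype.subsetP pA _ vp) in vA.
apply/subset_leq_card/fintype.subsetP => _ /imsetP[[p v] + ->].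
rewrite !inE /= => /andP[/andP[pA /eqP p2] vA].
rewrite fA // p2 eqxx andbT cardsU1 p2.
by have [vp|//] := boolP (v \in p); rewrite (fintype.subsetP pA _ vp) in vA.
Qed.

(** A triple inside [A] contributes 2, and one meeting [A] in two points contributes 1. *)
Lemma sum_triples_subn1 (T : finType) (A : {set T}) :
  2 * 'C(#|A|, 3) + 'C(#|A|, 2) * (#|T| - #|A|) <=
  \sum_(e in triples T) (#|e :&: A| - 1).
Proof.
apply: leq_trans (leq_add (leqnn _) (card_triples_cross A)) _.
rewrite -cards_draws -!sum1_card big_distrr /=.
rewrite big_mkcond /= [X in _ + X]big_mkcond /= [leqRHS]big_mkcond /= -big_split /=.
apply: leq_sum => e _; rewrite !inE.
case: (eqVneq #|e| 3) => [e3|]; last by rewrite andbF.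
rewrite andbT; have [eA|_] := boolP (e \subset A).
  by rewrite (finset.setIidPl eA) e3.
by rewrite add0n /=; case: eqVneq => [->|].
Qed.

(** The four bounds on [Q] correspond, in order, to the values 3, 2, 1, 0 of the smallest
    intersection with [A] among the greedily chosen triples. *)
Lemma exists_dense_hypergraph (T : finType) (A : {set T}) (M Q : nat) :
  M <= 'C(#|T|, 3) ->
  Q <= 3 * M ->
  Q <= 2 * M + 'C(#|A|, 3) ->
  Q <= M + 2 * 'C(#|A|, 3) + 'C(#|A|, 2) * (#|T| - #|A|) ->
  Q <= #|A| * 'C(#|T|.-1, 2) ->
  exists E : {set {set T}}, [/\ uniform3 E, #|E| = M &
    Q <= \sum_(v in A) hdegree E v].
Proof.
rewrite -card_triples => MT Q3 Q2 Q1 Q0.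
have [E [EP EM top]] := top_set (fun e : {set T} => #|e :&: A|) MT.
have uE : uniform3 E.
  by move=> e /(fintype.subsetP EP); rewrite inE => /eqP.
exists E; split=> //; rewrite sum_hdegree.
have [M0|M0] := posnP M; first by rewrite M0 in Q3; apply: leq_trans Q3 _.
rewrite -EM in M0; have [e0 e0E ->] := top_set_weight EP M0 top.
rewrite EM; have : #|e0 :&: A| <= 3.
  by rewrite -(uE _ e0E) subset_leq_card // finset.subsetIl.
move: #|e0 :&: A| => k.
case: k => [_|[_|[_|[_|//]]]].
- by rewrite muln0 add0n (leq_trans Q0) // sum_triples_subn0.
- by rewrite muln1 (leq_trans Q1) // -addnA leq_add2l sum_triples_subn1.
- by rewrite (leq_trans Q2) // mulnC leq_add2l sum_triples_subn2.
- by rewrite mulnC (leq_trans Q3) // leq_addr.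
Qed.

(** * From a dense hypergraph to the prescribed degrees *)

(** Here [Q] is the degree sum to be reached on [A]: [a * U <= Q] makes the levelled degrees on [A]
    at least [U], and the next hypothesis makes those off [A] at most [L]. *)
Lemma realizable_criterion (T : finType) (d : T -> nat) (L U M a Q : nat) :
  a <= #|T| -> (forall v, L <= d v <= U) -> \sum_v d v = 3 * M ->
  M <= 'C(#|T|, 3) ->
  a * U <= Q -> 3 * M <= Q + (#|T| - a) * L ->
  Q <= 3 * M ->
  Q <= 2 * M + 'C(a, 3) ->
  Q <= M + 2 * 'C(a, 3) + 'C(a, 2) * (#|T| - a) ->
  Q <= a * 'C(#|T|.-1, 2) ->
  realizable d.
Proof.
move=> aT dLU dM MT aQ bQ Q3 Q2 Q1 Q0.
have aT' : a <= #|[set: T]| by rewrite cardsT.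
have [A [_ Aa Atop]] := top_set d aT'.
have Atop' x y : x \in A -> y \notin A -> d y <= d x.
  by move=> xA yA; apply: Atop; rewrite // !inE yA.
rewrite -Aa in Q2 Q1 Q0 aQ bQ.
have [E [uE EM EQ]] := exists_dense_hypergraph MT Q3 Q2 Q1 Q0.
have sumAC (f : T -> nat) : \sum_v f v = \sum_(v in A) f v + \sum_(v in ~: A) f v.
  by rewrite (bigID [in A]) /=; congr addn; apply: eq_bigl => v; rewrite !inE.
have cAC : #|~: A| = #|T| - #|A| by rewrite -(cardsC A) addKn.
have EM' : \sum_(v in A) hdegree E v + \sum_(v in ~: A) hdegree E v = 3 * M.
  by rewrite -sumAC handshake // EM.
have bal (B : {set T}) s : (#|B| = 0 -> s = 0) ->
    exists2 t : T -> nat, \sum_(v in B) t v = s &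
    {in B &, forall i j, t i <= (t j).+1}.
  have [B0 ->//|B0 _] := posnP #|B|; last exact: exists_balanced.
  exists (fun=> 0); first by rewrite big1.
  by [].
have sum0 (B : {set T}) (f : T -> nat) : #|B| = 0 -> \sum_(v in B) f v = 0.
  by move=> /eqP; rewrite cards_eq0 => /eqP ->; rewrite big_set0.
have [t1 t1s t1b] := bal A _ (@sum0 A (hdegree E)).
have [t2 t2s t2b] := bal (~: A) _ (@sum0 (~: A) (hdegree E)).
pose t v := if v \in A then t1 v else t2 v.
have tA : \sum_(v in A) t v = \sum_(v in A) hdegree E v.
  by rewrite -t1s; apply: eq_bigr => v; rewrite /t => ->.
have tB : \sum_(v in ~: A) t v = \sum_(v in ~: A) hdegree E v.
  by rewrite -t2s; apply: eq_bigr => v; rewrite inE /t => /negbTE ->.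
(* First transfer, inside each class, where the values of [t] differ by at most one. *)
have rt : realizable t.
  apply: (@realizable_transfer _ A (hdegree E)) => //; first by exists E.
  move=> i j; rewrite /t; have [iA|iA] := boolP (i \in A) => /esym.
    by move=> jA; rewrite jA => _ _; apply: t1b.
  by move=> jA; rewrite jA => _ _; apply: t2b; rewrite inE // jA.
have tU v : v \in A -> d v <= t v.
  move=> vA; rewrite /t vA; have /andP[_ dU] := dLU v; apply: leq_trans dU _.
  by apply: (balanced_ge t1b) => //; rewrite t1s (leq_trans aQ).
have tL v : v \notin A -> t v <= d v.
  move=> vA; rewrite /t (negbTE vA); have /andP[+ _] := dLU v; apply: leq_trans.
  apply: (balanced_le t2b); last by rewrite inE.
  rewrite t2s cAC -(leq_add2l (\sum_(v in A) hdegree E v)) EM'.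
  by apply: leq_trans bQ _; rewrite leq_add2r.
have noB (f g : T -> nat) : \sum_(v in ~: [set: T]) f v = \sum_(v in ~: [set: T]) g v.
  by rewrite finset.setCT !big_set0.
(* Second transfer, over all vertices: [t] exceeds [d] only in [A] and falls short only off [A],
   where [d] is no larger than on [A]. *)
apply: (@realizable_transfer _ [set: T] t) => //.
  transitivity (\sum_v t v); first by apply: eq_bigl => v; rewrite inE.
  transitivity (\sum_v d v); last by apply: eq_bigl => v; rewrite inE.
  by rewrite sumAC tA tB EM' dM.
move=> i j _ di dj; apply: leqW; apply: Atop'.
  by apply: contraTT di => /tL; rewrite -leqNgt.
by apply: contraTN dj => /tU; rewrite -leqNgt.
Qed.

End Combinatorics.

(** * Inequalities for [c1star] *)

(** [Cfun] is the maximum of its three branches, so [c1star] bounds both nonzero formulas at every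
    [a], whichever case applies. *)
Lemma c1star_ge (R : realType) (c2 a : R) : 0 < c2 < 1 -> 0 < a < 1 ->
  a * (c2 - a ^+ 2) <= 2 * (1 - a) * c1star c2 /\
  2 * a * (c2 - a ^+ 2) - 3 * a ^+ 2 * (1 - a) <= (1 - a) * c1star c2.
Proof.
move=> /andP[c0 c1] a01; have [_ /(_ a a01)] := c1star_max c0 c1.
move: a01 => /andP[a0 a1].
have b0 : 0 < 1 - a by lra.
rewrite /Cfun [2 * (c2 / 2)](_ : _ = c2); last by field.
have q0 : 0 < a / (1 - a) by rewrite divr_gt0.
have qE : a / (1 - a) * (1 - a) = a by rewrite divfK// gt_eqF.
rewrite -(mulrA 2 a).
move: (a / (1 - a)) q0 qE (c1star c2) => q q0 qE s.
pose g := q * (c2 - a ^+ 2).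
have gE : a * (c2 - a ^+ 2) = (1 - a) * g by rewrite -[X in X * _]qE /g; ring.
(* The branches [g / 2] and [2 * g - 3 * a ^+ 2] differ by 3/2 times this quantity, whose sign is
   what the second test of [Cfun] decides. *)
have g2E : g - 2 * a ^+ 2 = q * (c2 - (2 * a - a ^+ 2)).
  apply/eqP; rewrite /g -subr_eq0; apply/eqP.
  by transitivity (2 * a * (q * (1 - a) - a)); [ring|rewrite qE subrr mulr0].
have a20 : 0 < a ^+ 2 by rewrite exprn_gt0.
rewrite -(mulrA 2 q) (mulrA q) -/g => H.
suff [H1 H2] : g <= 2 * s /\ 2 * g - 3 * a ^+ 2 <= s.
  rewrite -(mulrA 2 a) gE; split.
    by rewrite (mulrC 2) -mulrA ler_pM2l.
  rewrite [leLHS](_ : _ = (1 - a) * (2 * g - 3 * a ^+ 2)); last by ring.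
  by rewrite ler_pM2l.
move: H; case: ifPn => [H1|]; last rewrite -ltNge => H1.
  have : g <= 0 by rewrite /g pmulr_rle0//; lra.
  by move=> *; split; lra.
case: ifPn => [H2|]; last rewrite -ltNge => H2.
  have : g - 2 * a ^+ 2 <= 0 by rewrite g2E pmulr_rle0//; nra.
  by move=> *; split; lra.
have : 0 < g - 2 * a ^+ 2 by rewrite g2E pmulr_rgt0//; nra.
by move=> *; split; lra.
Qed.

(** At [(1 + c2) / 2], whose square is at least [c2], the zero branch applies. *)
Lemma c1star_ge0 (R : realType) (c2 : R) : 0 < c2 < 1 -> 0 <= c1star c2.
Proof.
move=> /andP[c0 c1]; have [_ H] := c1star_max c0 c1.
apply: le_trans (H ((1 + c2) / 2) _); last by apply/andP; split; lra.
by rewrite /Cfun ifT //; nra.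
Qed.

(* The second bound of [c1star_ge] at [a = 1 - e / 2], where [e = c1 - c1star c2]. *)
Lemma c1star_gap (R : realType) (c2 c1 : R) : 0 < c2 < 1 -> c1 <= c2 ->
  c1star c2 < c1 -> (c1 - c1star c2) ^+ 2 <= 8 * (1 - c2).
Proof.
move=> c2b c12 sc1; have s0 := c1star_ge0 c2b; move: (c2b) => /andP[c0 c1'].
set s := c1star c2 in s0 sc1 *.
have [//||_ +] := @c1star_ge _ c2 (1 - (c1 - s) / 2); first by apply/andP; split; lra.
rewrite -/s.
(* With [e] the gap, this reads [s <= 1 - e]; the terms linear in [e] then cancel, leaving a
   quadratic one to be bounded by [1 - c2]. *)
have : c1 - s <= 1 - s by lra.
move: (c1 - s) (subr_gt0 s c1) => e; rewrite sc1 => /idP e0 e1.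
rewrite subKr => H.
pose t := 1 - c2.
have {H} : e / 2 * (1 - e ^+ 2 / 4) - 2 * (1 - e / 2) * t <= e / 2 * s.
  by move: H; rewrite /t; nra.
have : 0 <= t by rewrite /t; lra.
by rewrite -/t; nra.
Qed.

(** * Real estimates for a large and for a small complement of [A] *)

Lemma natr_bin2 (R : realType) (n : nat) : 'C(n, 2)%:R = n%:R * (n%:R - 1) / 2 :> R.
Proof.
elim: n => [|n IH]; first by rewrite bin0n /=; field.
by rewrite binS bin1 natrD IH -natr1; field.
Qed.

Lemma natr_bin3 (R : realType) (n : nat) :
  'C(n, 3)%:R = n%:R * (n%:R - 1) * (n%:R - 2) / 6 :> R.
Proof.
elim: n => [|n IH]; first by rewrite bin0n /=; field.
by rewrite binS natrD IH natr_bin2 -natr1; field.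
Qed.

(* [x], [y] are the sizes of [A] and its complement, and [rho] the excess of
   [x * U + y * L] over the degree sum. *)
Lemma large_low_class (R : realType) (c2 s e x y L U rho : R) :
  let n := x + y in let C := (n - 1) * (n - 2) / 2 in
  0 < c2 < 1 -> 0 <= s -> 0 < e -> 0 <= x -> 0 <= y -> 40 <= n * e -> 20 <= n ->
  (forall a, 0 < a < 1 -> a * (c2 - a ^+ 2) <= 2 * (1 - a) * s) ->
  (forall a, 0 < a < 1 ->
     2 * a * (c2 - a ^+ 2) - 3 * a ^+ 2 * (1 - a) <= (1 - a) * s) ->
  (s + e) * C <= L -> U <= c2 * C -> rho <= C -> 2 <= y * e ->
  [/\ rho <= y * L,
      x * U + 2 * rho <= 2 * (y * L) + x * (x - 1) * (x - 2) / 2 &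
      2 * (x * U) + rho <= y * L + x * (x - 1) * (x - 2) + 3 * (x * (x - 1) / 2 * y)].
Proof.
move=> n C /andP[c0 c1] s0 e0 x0 y0 ne n20 F1 F2 HL HU Hr ye.
have nE : x = n - y by rewrite addrK.
have CE : C = (n - 1) * (n - 2) / 2 by [].
clearbody C; clearbody n.
have y1 : 0 < y by rewrite -(pmulr_lgt0 _ e0); lra.
have n0 : 0 < n by lra.
have C0 : 0 < C by rewrite CE; nra.
have Cn : n ^+ 2 <= 4 * C by rewrite CE; nra.
have Ce : 10 * n <= C * e.
  have := ler_wpM2l (ltW n0) ne.
  have : n ^+ 2 * e <= 4 * C * e by rewrite ler_pM2r.
  by rewrite expr2; lra.
(* The slack [y * e * C] is at least [2 * rho] by this line and at least [10 * (n * y)] by the next;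
   the last goal costs only [rho + 9 / 2 * (n * y)]. *)
have yCe : 2 * C <= y * e * C by rewrite ler_pM2r.
have yCe' : 10 * (n * y) <= y * e * C.
  by have := ler_wpM2l y0 Ce; lra.
have yL : y * s * C + y * e * C <= y * L.
  by have := ler_wpM2l y0 HL; lra.
have ysC : 0 <= y * s * C by exact: mulr_ge0 (mulr_ge0 y0 s0) (ltW C0).
have xU : x * U <= x * c2 * C by have := ler_wpM2l x0 HU; lra.
have ny : 0 <= n * y by exact: mulr_ge0 (ltW n0) y0.
have yCL : rho <= y * L by lra.
(* The hypotheses on [s] require a positive proportion [x / n]. *)
move: (x0); rewrite le_eqVlt => /predU1P[x00|xgt0].
  by rewrite -x00; split; lra.
pose a := x / n.
have xE : x = a * n by rewrite /a divfK // gt_eqF.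
have yE : y = (1 - a) * n by rewrite mulrBl mul1r -xE; lra.
have a0 : 0 < a by rewrite divr_gt0.
have a1 : a < 1 by rewrite ltr_pdivrMr // mul1r; lra.
have a01 : 0 < a < 1 by rewrite a0.
have nC : 0 <= n * C by exact: mulr_ge0 (ltW n0) (ltW C0).
have G1 : x * c2 * C - x * a ^+ 2 * C <= 2 * (y * s * C).
  by have := ler_wpM2r nC (F1 _ a01); rewrite [in X in _ -> X]xE [in X in _ -> X]yE; lra.
have G2 : 2 * (x * c2 * C) - 2 * (x * a ^+ 2 * C) - 3 * (a ^+ 2 * y * C) <= y * s * C.
  by have := ler_wpM2r nC (F2 _ a01); rewrite [in X in _ -> X]xE [in X in _ -> X]yE; lra.
have a2 : a ^+ 2 <= 1 by rewrite expr_le1 // ltW.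
(* With [x = a * n] the cubic terms of both sides agree, and the remainder is at most
   [3 / 2 * (a ^+ 2 * (n * y))]. *)
have Ha : x * a ^+ 2 * C <= x * (x - 1) * (x - 2) / 2 + 3 / 2 * (n * y).
  have : a ^+ 2 * (n * y) <= n * y by rewrite -[leRHS]mul1r ler_wpM2r.
  have : 0 <= x * (1 - a ^+ 2) by rewrite mulr_ge0 // subr_ge0.
  rewrite yE xE CE; lra.
have Hb : 3 * (a ^+ 2 * y * C) <= 3 * (x * (x - 1) / 2 * y) + 3 / 2 * (n * y).
  suff : 2 * (a ^+ 2 * C) <= x * (x - 1) + n by move=> /(ler_wpM2r y0); lra.
  have : 0 <= a ^+ 2 * n - a ^+ 2.
    by rewrite -[X in _ - X]mulr1 -mulrBr mulr_ge0 ?sqr_ge0 // subr_ge0; lra.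
  have : 0 <= a ^+ 2 * n by rewrite mulr_ge0 ?sqr_ge0 // ltW.
  have : a * n <= n by rewrite -[leRHS]mul1r ler_pM2r // ltW.
  by rewrite xE CE; lra.
by split; lra.
Qed.

(* Here [r] is the excess of the degree sum over [x * U + y * L]. *)
Lemma small_low_class (R : realType) (c2 e x y U r : R) :
  let n := x + y in let C := (n - 1) * (n - 2) / 2 in
  0 < e <= 1 -> e ^+ 2 <= 8 * (1 - c2) -> 0 <= y -> y * e <= 3 ->
  1000 <= n * e ^+ 3 -> U <= c2 * C -> r <= C ->
  0 <= x /\ x * U + r <= x * (x - 1) * (x - 2) / 2.
Proof.
move=> n C /andP[e0 e1] ec y0 ye ne HU Hr.
have nE : x = n - y by rewrite addrK.
have CE : C = (n - 1) * (n - 2) / 2 by [].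
clearbody C; clearbody n.
have e30 : 0 < e ^+ 3 by rewrite exprn_gt0.
have n0 : 0 < n by rewrite -(pmulr_lgt0 _ e30); lra.
have e2e : e ^+ 2 <= e by rewrite expr2 ger_pMr.
have e32 : e ^+ 3 <= e ^+ 2 by rewrite exprSr ger_pMr // exprn_gt0.
have n1000 : 1000 <= n.
  by apply: le_trans ne _; rewrite ger_pMr //; lra.
have ne1 : 1000 <= n * e by apply: le_trans ne _; rewrite ler_pM2l //; lra.
have ne2 : 1000 <= n * e ^+ 2 by apply: le_trans ne _; rewrite ler_pM2l.
have Cn : n ^+ 2 <= 4 * C by rewrite CE; nra.
have C0 : 0 < C by nra.
have yn : 2 * y <= n by rewrite -(ler_pM2r e0); lra.
have xn : n <= 2 * x by lra.
have x0 : 0 < x by lra.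
split; first exact: ltW.
(* Half of the margin [x * (1 - c2) * C] pays for [r]; by [ynC] the other half pays for replacing
   [C] by [(x - 1) * (x - 2) / 2]. *)
have xt : 2 <= x * (1 - c2).
  have : n * e ^+ 2 <= 2 * x * (8 * (1 - c2)).
    by apply: ler_pM; rewrite // ?sqr_ge0 // ltW.
  by lra.
have ynC : 2 * (y * n) <= (1 - c2) * C.
  rewrite -(ler_pM2r e0).
  have h1 : e ^+ 2 * n ^+ 2 <= 8 * (1 - c2) * (4 * C).
    by apply: ler_pM; rewrite // sqr_ge0.
  have := ler_wpM2r (ltW e0) h1.
  have := ler_wpM2l (ltW n0) ne; have := ler_wpM2l (ltW n0) ye.
  by rewrite exprS; lra.
have h2 := ler_wpM2l (ltW x0) ynC.
have h3 := ler_wpM2r (ltW C0) xt.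
have h4 := ler_wpM2l (ltW x0) HU.
have h5 : x * (2 * C - 2 * (y * n)) <= x * ((x - 1) * (x - 2)).
  by rewrite ler_pM2l // nE CE; nra.
by lra.
Qed.

(** * Choice of the class size and conclusion *)

Lemma exists_bounds (n : nat) (d : 'I_n -> nat) : (0 < n)%N ->
  exists i j : 'I_n, forall v, (d i <= d v <= d j)%N.
Proof.
move=> n0; have [i _ imin] := arg_minnP d (isT : xpredT (Ordinal n0)).
have [j _ jmax] := arg_maxnP d (isT : xpredT (Ordinal n0)).
by exists i, j => v; apply/andP; split; [exact: imin|exact: jmax].
Qed.

(** Take the least [a] whose two-valued total reaches [S]. One step adds at most [U], so rounding up
    to [a] or down to [a.-1] misses [S] by at most [U]; both roundings get used. *)
Lemma exists_split (n S L U : nat) : (n * L <= S <= n * U)%N ->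
  exists2 a, (a <= n)%N & (S <= a * U + (n - a) * L <= S + U)%N /\
    (0 < a -> a.-1 * U + (n - a.-1) * L <= S <=
              a.-1 * U + (n - a.-1) * L + U)%N.
Proof.
move=> /andP[SL SU].
have ex : exists a, (S <= a * U + (n - a) * L)%N.
  by exists n; rewrite subnn mul0n addn0.
case: (ex_minnP ex) => a aS amin.
have an : (a <= n)%N by apply: amin; rewrite subnn mul0n addn0.
exists a => //; case: a an aS amin => [|a] an aS amin.
  by split=> //; rewrite aS mul0n subn0 add0n (leq_trans SL) // leq_addr.
have : (a * U + (n - a) * L < S)%N.
  by rewrite ltnNge; apply/negP => /amin; rewrite ltnn.
move: aS; rewrite /= mulSn -(subnSK an) mulSn => aS aS'.
move: ((n - a.+1) * L)%N (a * U)%N aS aS' => p q.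
by clear=> *; split=> [|_]; apply/andP; split; lia.
Qed.

Lemma realizable_between (R : realType) (c1 c2 : R) (n M : nat) (d : 'I_n -> nat) :
  0 < c2 < 1 -> c1 <= c2 -> c1star c2 < c1 ->
  1000 <= n%:R * (c1 - c1star c2) ^+ 3 ->
  (forall v, c1 * 'C(n.-1, 2)%:R <= (d v)%:R <= c2 * 'C(n.-1, 2)%:R) ->
  (\sum_v d v = 3 * M)%N -> realizable d.
Proof.
move=> c2b c12 sc1 ne dc dM.
have gap := c1star_gap c2b c12 sc1; have s0 := c1star_ge0 c2b.
have F a : 0 < a < 1 -> _ := @c1star_ge R c2 a c2b.
have c1E : c1 = c1star c2 + (c1 - c1star c2) by rewrite addrC subrK.
have e1 : 0 < c1 - c1star c2 <= 1 by move: c2b => /andP[_ ?]; apply/andP; split; lra.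
move: (c1star c2) (c1 - c1star c2) s0 F c1E e1 gap ne => s e s0 F c1E /andP[e0 e1] gap ne.
have n0 : (0 < n)%N by case: n {d dc dM} ne => //; rewrite mul0r; lra.
have nR : n%:R = n.-1%:R + 1 :> R by rewrite natr1 prednK.
have CE : 'C(n.-1, 2)%:R = (n%:R - 1) * (n%:R - 2) / 2 :> R.
  by rewrite natr_bin2 nR; field.
(* Taking the attained extreme degrees as [L] and [U] avoids rounding the real bounds. *)
have [i [j dij]] := exists_bounds d n0.
have /andP[HL _] := dc i; have /andP[_ HU] := dc j.
have UC : (d j <= 'C(n.-1, 2))%N.
  rewrite -(ler_nat R) (le_trans HU) // ler_piMl ?ler0n //.
  by case/andP: c2b => _ /ltW.
move: (d i) (d j) dij HL HU UC => L U dLU HL HU UC.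
have e30 : 0 < e ^+ 3 by rewrite exprn_gt0.
have e3e : e ^+ 3 <= e by rewrite exprS ger_pMr // expr_le1 // ltW.
have ne1 : 1000 <= n%:R * e by apply: le_trans ne _; rewrite ler_pM2l // ltr0n.
have n1000 : 1000 <= n%:R :> R.
  by apply: le_trans ne1 _; rewrite ger_pMr // ltr0n.
have SU : (3 * M <= n * U)%N.
  rewrite -dM -[n in leqRHS]card_ord -sum_nat_const.
  by apply: leq_sum => v _; have /andP[] := dLU v.
have SL : (n * L <= 3 * M)%N.
  rewrite -dM -[n in leqLHS]card_ord -sum_nat_const.
  by apply: leq_sum => v _; have /andP[] := dLU v.
have Mn : (M <= 'C(n, 3))%N.
  rewrite -(@leq_pmul2l 3) // -mul_bin_diag (leq_trans SU) //.
  by rewrite leq_mul2l UC orbT.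
have [|a an [/andP[aS aSU] amin]] := @exists_split n (3 * M) L U.
  by rewrite SL.
have crit := @realizable_criterion _ d L U M.
rewrite card_ord in crit.
(* Large complement: round up and take [Q = a * U], the least value allowed. *)
have [ye|ye] := lerP 2 ((n - a)%:R * e).
  pose rho := (a * U + (n - a) * L - 3 * M)%N.
  have rhoE : (3 * M + rho = a * U + (n - a) * L)%N by rewrite subnKC.
  have rhoU : (rho <= U)%N by rewrite -(leq_add2l (3 * M)) rhoE.
  clearbody rho.
  have rE : 3 * M%:R + rho%:R = a%:R * U%:R + (n - a)%:R * L%:R :> R.
    by rewrite -!natrM -!natrD rhoE.
  have xyE : a%:R + (n - a)%:R = n%:R :> R by rewrite -natrD subnKC.
  have := @large_low_class R c2 s e a%:R (n - a)%:R L%:R U%:R rho%:R.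
  rewrite /= xyE -CE -c1E => H.
  have [] := H c2b s0 e0 (ler0n _ _) (ler0n _ _) _ _
    (fun a ha => (F a ha).1) (fun a ha => (F a ha).2) HL HU _ ye; first by lra.
  - by lra.
  - by rewrite ler_nat (leq_trans rhoU).
  move=> H1 H2 H3 {H}.
  apply: (crit a (a * U)%N) => //; rewrite -?(ler_nat R) ?natrD ?natrM ?natr_bin3 ?natr_bin2.
  - by lra.
  - by lra.
  - by lra.
  - by rewrite -natr_bin2 -!natrM ler_nat leq_mul2l UC orbT.
(* Small complement: round down and put the remainder [r] into [Q], leaving exactly [(n - a') * L]
   for the complement. *)
have a0 : (0 < a)%N.
  rewrite lt0n; apply: contraTN ye => /eqP->; rewrite subn0 -leNgt; lra.
have := amin a0; set a' := a.-1 => /andP[aS' aSU'].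
have aE : a = a'.+1 by rewrite prednK.
have a'n : (a' < n)%N by rewrite -aE.
pose r := (3 * M - (a' * U + (n - a') * L))%N.
have rE : (3 * M = a' * U + (n - a') * L + r)%N by rewrite subnKC.
have rU : (r <= U)%N by rewrite leq_subLR.
clearbody r.
have rE' : 3 * M%:R = a'%:R * U%:R + (n - a')%:R * L%:R + r%:R :> R.
  by rewrite -!natrM -!natrD -rE.
have xyE : a'%:R + (n - a')%:R = n%:R :> R by rewrite -natrD subnKC // ltnW.
have := @small_low_class R c2 e a'%:R (n - a')%:R U%:R r%:R.
rewrite /= xyE -CE e0 e1 => /(_ isT gap (ler0n _ _)) H.
have {H} [||_ Q3] := H _ ne HU.
(* Rounding down adds one vertex to the complement, hence [e <= 1] to a product below 2. *)
- by rewrite -subSS -aE subSn // -natr1 mulrDl mul1r; lra.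
- by rewrite ler_nat (leq_trans rU).
have yL : 0 <= (n - a')%:R * L%:R :> R by rewrite mulr_ge0.
(* Together with [QM] this gives the two middle bounds of the criterion by weighted averaging. *)
have Q3' : (a' * U + r <= 3 * 'C(a', 3))%N.
  by rewrite -(ler_nat R) natrD !natrM natr_bin3; lra.
have QM : (a' * U + r <= 3 * M)%N by rewrite rE addnAC leq_addr.
apply: (crit a' (a' * U + r)%N) => //.
- exact: ltnW.
- exact: leq_addr.
- by rewrite rE addnAC.
- by move: QM Q3'; clear; lia.
- by apply: leq_trans (leq_addr _ _); move: QM Q3'; clear; lia.
- apply: leq_trans Q3' _; rewrite -mul_bin_diag leq_mul2l leq_bin2l ?orbT //.
  by rewrite -!subn1 leq_sub2r // ltnW.
Qed.

Theorem theorem3p14 (R : realType) :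
  exists (p : {poly R}) (K : R), 0 < K /\
  forall c1 c2 : R, 0 < c1 -> c1 <= c2 -> c2 < 1 -> c1star c2 < c1 ->
  exists n0 : nat,
    n0%:R <= K * p.[1 / (c1 - c1star c2)] /\
    (forall n : nat, (n0 <= n)%N -> forall D : n.-tuple nat,
       degrees_between c1 c2 D ->
       (graphic D <-> (3 %| \sum_(i < n) tnth D i)%N)) /\
    (forall n : nat, (n0 <= n)%N -> forall D : n.-tuple nat,
       degree_class c1 c2 D -> graphic D).
Proof.
(* With [x = (c1 - c1star c2) ^- 3 >= 1], the threshold is at most [1000 * x + 1 <= 1001 * x]; the
   1000 comes from [realizable_between]. *)
exists 'X^3, 1001; split; first by rewrite ltr0n.
move=> c1 c2 c10 c12 c21 sc1.
have c2b : 0 < c2 < 1 by rewrite c21 (lt_le_trans c10).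
have e0 : 0 < c1 - c1star c2 by rewrite subr_gt0.
have e1 : c1 - c1star c2 <= 1 by have := c1star_ge0 c2b; lra.
have e3 : 0 < (c1 - c1star c2) ^+ 3 by rewrite exprn_gt0.
pose x := (c1 - c1star c2) ^- 3.
have x0 : 0 < x by rewrite invr_gt0.
have x1 : 1 <= x by rewrite invf_ge1 // expr_le1 // ltW.
exists (Num.truncn (1000 * x)).+1.
have main n (D : n.-tuple nat) : (Num.truncn (1000 * x) < n)%N ->
    degrees_between c1 c2 D -> (3 %| \sum_(i < n) tnth D i)%N -> graphic D.
  move=> nx Db /dvdnP[M SM].
  have [||E uE Ed] := @realizable_between R c1 c2 n M (tnth D) c2b c12 sc1 _ Db.
  - rewrite -ler_pdivrMr // -/x; apply/ltW; apply: lt_le_trans (truncnS_gt _) _.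
    by rewrite ler_nat.
  - by rewrite SM mulnC.
  - by exists E.
split.
  rewrite hornerXn expr_div_n expr1n mul1r -/x.
  have : (Num.truncn (1000 * x))%:R <= 1000 * x by rewrite truncn_le; lra.
  by rewrite -natr1; lra.
split=> [n nx D Db|n nx D [S3 Db]]; last by apply: main => //; rewrite /dvdn S3.
split; last exact: main.
move=> [E [uE Ed]]; apply/dvdnP; exists #|E|; rewrite mulnC -handshake //.
by apply: eq_bigr => v _; rewrite Ed.
Qed.
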